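(* Let $n\ge2$, $(\pi,v)\in\operatorname{Vert}(B_n)$ and $a,b\in v([n])$. Then $(\pi,v)$ has a rise labelled $(a,b)$ if and only if $\zeta_B(\pi,v)=(\zeta_B(\pi),d_B(\pi,v))$ has a valley labelled $(b,a)$ or $(-a,-b)$. Furthermore, $\pi$ begins with a North step if and only if $\zeta_B(\pi,v)$ has a valley labelled $(v(1),0)$.
   Context: $\mathcal L_{n,n}$: words in $\{N,E\}$ with $n$ of each letter; $\mathcal B_{2n}$: words of length $2n$ whose prefixes have at least as many $N$'s as $E$'s. Rise $i$: the $i$-th North step is immediately followed by a North step. Valley $(i,j)$: the $i$-th East step is immediately followed by the $j$-th North step; also $(i,j+1)$ if a ballot path with $i$ East and $j$ North steps ends with an East step. $\mathfrak S_n^B$: bijections $w$ of $\{\pm1,\dots,\pm n\}$ with $w(-i)=-w(i)$; we set $w(0)=0$. $\operatorname{Vert}(B_n)$: pairs $(\pi,v)$ with $\pi\in\mathcal L_{n,n}$, $v\in\mathfrak S_n^B$, $v(i)<v(i+1)$ for every rise $i$ of $\pi$, and $v(1)>0$ if $\pi$ begins with a North step. For $\pi$: $\pi_i$ = number of East steps before the $i$-th North step; $\lambda_i=\pi_i$ ($i<n$), $\lambda_n=2\pi_n-\pi_{n-1}$ if $\pi_1+\dots+\pi_{n-2}$ even, $2n+1-2\pi_n+\pi_{n-1}$ if odd; area vector $\mu_i=\lambda_i-i$ ($i<n$), $\mu_n=\lambda_n-n$ if $n\equiv0,3\pmod4$, $\mu_n=n+1-\lambda_n$ if $n\equiv1,2\pmod4$.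 For $a\in\mathbb Z^n$, $j\ge0$: $\overrightarrow{S}^+_j(a)$ reads $a$ left to right writing $N$ for entries $j$, $E$ for entries $j+1$; $\overleftarrow{S}^+_j(a)$ reads right to left; $\overrightarrow{S}^-_j,\overleftarrow{S}^-_j$ likewise with $N$ for $-j$, $E$ for $-j-1$. $\zeta_B(\pi)=\overleftarrow{S}^-_{2n}(\mu)\overrightarrow{S}^+_{2n}(\mu)\cdots\overleftarrow{S}^-_1(\mu)\overrightarrow{S}^+_1(\mu)\overleftarrow{S}^-_0(\mu)(N\overrightarrow{S}^+_0(\mu))^\circ$, $(\cdot)^\circ$ deleting the last letter. $d_B(\pi,v)$: for $i=0,1,2,\dots$ write $v(j)$ for rows $j$ with $\mu_j=-i$ in increasing $j$, then $-v(j)$ for rows $j$ with $\mu_j=i+1$ in decreasing $j$; finally, if $\mu_{n-1}+\mu_n$ is even, change the sign of the entry coming from row $n$; the result is the window of $d_B(\pi,v)\in\mathfrak S_n^B$. Labels: a rise $i$ of $(\pi,v)$ is labelled $(v(i),v(i+1))$; for $\beta\in\mathcal B_{2n}$ and $w\in\mathfrak S_n^B$, a valley $(i,j)$ of $\beta$ is labelled $(w(n+1-i),w(n+1-j))$ (using $w(0)=0$, $w(-k)=-w(k)$). *)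

(* Defs.v *)
From HB Require Import structures.
From mathcomp Require Import all_boot all_order all_algebra zify.

Set Implicit Arguments.
Unset Strict Implicit.
Unset Printing Implicit Defensive.

Import Order.TTheory GRing.Theory Num.Theory.
Local Open Scope ring_scope.

Inductive step := North | East.

Definition bool_of_step (c : step) := if c is North then true else false.
Definition step_of_bool (b : bool) := if b then North else East.
Lemma bool_of_stepK : cancel bool_of_step step_of_bool.
Proof. by case. Qed.
HB.instance Definition _ := Equality.copy step (can_type bool_of_stepK).

Definition lattice_path (n : nat) (s : seq step) : bool :=
  (count_mem North s == n) && (count_mem East s == n).

Definition begins_north (s : seq step) : bool := ohead s == Some North.

(* The i-th occurrence (i >= 1) of the letter c in s is at the 0-based
   position p. *)
Definition ith_step (c : step) (i : nat) (s : seq step) (p : nat) : bool :=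
  (onth s p == Some c) && (count_mem c (take p.+1 s) == i).

Definition rise (s : seq step) (i : nat) : Prop :=
  exists p, ith_step North i s p && (onth s p.+1 == Some North).

(* The second disjunct is the convention for ballot paths ending with an East
   step; it is not meant for other words. *)
Definition valley (s : seq step) (i j : nat) : Prop :=
  (exists p, ith_step East i s p && ith_step North j s p.+1) \/
  [/\ last North s = East, count_mem East s = i & (count_mem North s).+1 = j].

Definition pm (n : nat) : pred int := [pred i : int | 0 < `|i| <= n%:Z].

(* An element of the hyperoctahedral group, extended by w 0 = 0; the values of
   w outside {-n, .., n} are irrelevant. *)
Definition signed_perm (n : nat) (w : int -> int) : Prop :=
  [/\ {in pm n, forall i, w i \in pm n},
      {in pm n &, injective w},
      {in pm n, forall k, exists2 i, i \in pm n & w i = k},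
      {in pm n, forall i, w (- i) = - w i}
    & w 0 = 0].

(* The odd function with values w(1), w(2), .. listed in s. *)
Definition of_window (s : seq int) (i : int) : int :=
  match i with
  | Posz 0 => 0
  | Posz k.+1 => s`_k
  | Negz k => - s`_k
  end.

Definition VertB (n : nat) (x : seq step * (int -> int)) : Prop :=
  [/\ lattice_path n x.1, signed_perm n x.2,
      forall i : nat, rise x.1 i -> x.2 i%:Z < x.2 i.+1%:Z
    & begins_north x.1 -> 0 < x.2 1].

(* easts_before s i is the number of East steps before the i-th North step,
   for 1 <= i <= count_mem North s. *)
Definition easts_before (s : seq step) (i : nat) : nat :=
  nth 0%N [seq count_mem East (take p s) | p <- iota 0 (size s)
                                          & onth s p == Some North] i.-1.

Definition lambda_B (n : nat) (s : seq step) (i : nat) : int :=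
  let e k : int := (easts_before s k)%:Z in
  if i == n then
    if odd (\sum_(1 <= k < n.-1) easts_before s k)%N
    then 2 * n%:Z + 1 - 2 * e n + e n.-1
    else 2 * e n - e n.-1
  else e i.

Definition mu_B (n : nat) (s : seq step) (i : nat) : int :=
  if (i == n) && ((n %% 4)%N \in [:: 1; 2]%N)
  then n%:Z + 1 - lambda_B n s n
  else lambda_B n s i - i%:Z.

Definition area_vector (n : nat) (s : seq step) : seq int :=
  [seq mu_B n s i | i <- iota 1 n].

(* Reads a from left to right, writing North for x and East for y. *)
Definition read_word (x y : int) (a : seq int) : seq step :=
  pmap (fun z => if z == x then Some North
                 else if z == y then Some East else None) a.

Definition Sright_pos (j : nat) (a : seq int) : seq step :=
  read_word j%:Z (j%:Z + 1) a.

Definition Sleft_neg (j : nat) (a : seq int) : seq step :=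
  read_word (- j%:Z) (- j%:Z - 1) (rev a).

(* belast x s is x :: s without its last letter. *)
Definition zeta_path (n : nat) (s : seq step) : seq step :=
  let mu := area_vector n s in
  flatten [seq Sleft_neg j mu ++ Sright_pos j mu | j <- rev (iota 1 (2 * n))]
  ++ Sleft_neg 0 mu ++ belast North (Sright_pos 0 mu).

(* All the entries of the area vector of a lattice path lie in
   {-2n, .., 2n+1} (mu_B_bound), so stopping at i = 2n exhausts the rows. *)
Definition dB_window (n : nat) (s : seq step) (v : int -> int) : seq int :=
  let mu := mu_B n s in
  let flip (j : nat) (x : int) : int :=
    if (j == n) && (2 %| mu n.-1 + mu n)%Z then - x else x in
  flatten [seq [seq flip j (v j%:Z) | j <- iota 1 n & mu j == - i%:Z] ++
               [seq flip j (- v j%:Z) | j <- rev (iota 1 n) & mu j == i%:Z + 1]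
          | i <- iota 0 (2 * n).+1].

Definition dB (n : nat) (s : seq step) (v : int -> int) : int -> int :=
  of_window (dB_window n s v).

Definition zetaB (n : nat) (x : seq step * (int -> int)) :
    seq step * (int -> int) :=
  (zeta_path n x.1, dB n x.1 x.2).

Definition has_rise (x : seq step * (int -> int)) (a b : int) : Prop :=
  exists2 i : nat, rise x.1 i & (x.2 i%:Z, x.2 i.+1%:Z) = (a, b).

Definition has_valley (n : nat) (x : seq step * (int -> int)) (a b : int) :
    Prop :=
  exists i j : nat, valley x.1 i j /\
    (x.2 (n%:Z + 1 - i%:Z), x.2 (n%:Z + 1 - j%:Z)) = (a, b).

Lemma easts_before_le n s i : lattice_path n s -> (easts_before s i <= n)%N.
Proof.
case/andP => _ /eqP <-; rewrite /easts_before.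
set t := map _ _; have [ti|ti] := leqP (size t) i.-1; first by rewrite nth_default.
have /mapP[p _ ->] : nth 0%N t i.-1 \in t by apply: mem_nth.
by rewrite -[in leqRHS](cat_take_drop p s) count_cat leq_addr.
Qed.

Lemma pmE n i : (i \in pm n) = (0 < absz i <= n)%N.
Proof. by rewrite inE; lia. Qed.

Lemma mu_B_bound n s i : lattice_path n s -> (0 < i <= n)%N ->
  - (2 * n%:Z) <= mu_B n s i <= 2 * n%:Z + 1.
Proof.
move=> sP i_n; rewrite /mu_B /lambda_B eqxx.
have := easts_before_le i sP; have := easts_before_le n sP.
have := easts_before_le n.-1 sP.
case: (eqVneq i n) => [->|_] /=; last by lia.
by case: (_ \in _); case: odd; lia.
Qed.

Lemma of_window_signed_perm n (s : seq int) :
  perm_eq [seq absz x | x <- s] (iota 1 n) -> signed_perm n (of_window s).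
Proof.
move=> sP; have ssz : size s = n by rewrite -(size_map absz) (perm_size sP) size_iota.
have su : uniq [seq absz x | x <- s] by rewrite (perm_uniq sP) iota_uniq.
have sm k : (k < n)%N -> (0 < absz (nth 0%R s k) <= n)%N.
  move=> kn; have : absz (nth 0 s k) \in iota 1 n.
    by rewrite -(perm_mem sP) map_f // mem_nth ?ssz.
  by rewrite mem_iota; lia.
have sinj k l : (k < n)%N -> (l < n)%N -> absz (nth 0 s k) = absz (nth 0 s l) -> k = l.
  move=> kn ln E; apply/eqP; rewrite -(nth_uniq 0%N _ _ su) ?size_map ?ssz //.
  by rewrite !(nth_map 0) ?ssz // E.
have odd_w i : of_window s (- i) = - of_window s i.
  by case: i => [[|k]|k] //=; rewrite opprK.
have wE i : i <> 0 -> absz (of_window s i) = absz (nth 0 s (absz i).-1).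
  by case: i => [[|k]|k] //= _; rewrite abszN.
split=> //.
- by move=> i; rewrite !pmE => i_n; rewrite wE; [apply: sm; lia | lia].
- move=> k l; rewrite !pmE => kn ln E.
  have kl : (absz k).-1 = (absz l).-1.
    by apply: sinj; [lia | lia | rewrite -!wE ?E //; lia].
  have [//|kNl] : k = l \/ k = - l by lia.
  have wl : (0 < absz (of_window s l) <= n)%N by rewrite wE; [apply: sm; lia | lia].
  by move: E; rewrite kNl odd_w; lia.
- move=> k; rewrite pmE => kn.
  have : absz k \in [seq absz x | x <- s] by rewrite (perm_mem sP) mem_iota; lia.
  case/mapP => x /(nthP 0)[p]; rewrite ssz => pn <- kx.
  have [E|E] : k = nth 0 s p \/ k = - nth 0 s p.
    by move: (nth 0 s p) kx => y; lia.
    by exists (Posz p.+1); [rewrite pmE; lia | rewrite E].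
  by exists (- Posz p.+1); [rewrite pmE abszN; lia | rewrite odd_w E].
Qed.

Lemma signed_perm_window n v : signed_perm n v ->
  perm_eq [seq absz (v j%:Z) | j <- iota 1 n] (iota 1 n).
Proof.
case=> vin vinj _ vodd _.
have u : uniq [seq absz (v j%:Z) | j <- iota 1 n].
  rewrite map_inj_in_uniq ?iota_uniq // => j k; rewrite !mem_iota => jn kn E.
  have jP : j%:Z \in pm n by rewrite pmE; lia.
  have kP : k%:Z \in pm n by rewrite pmE; lia.
  have nkP : - k%:Z \in pm n by rewrite pmE; lia.
  have [F|F] : v j%:Z = v k%:Z \/ v j%:Z = - v k%:Z by lia.
    by have := vinj _ _ jP kP F; lia.
  by rewrite -vodd // in F; have := vinj _ _ jP nkP F; lia.
apply: uniq_perm; rewrite ?iota_uniq //.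
apply: (uniq_min_size u _ _).2; last by rewrite size_map !size_iota.
move=> _ /mapP[j jn ->]; move: jn; rewrite !mem_iota => jn.
by have := vin j%:Z; rewrite !pmE; lia.
Qed.

Lemma dB_signed_perm n s v :
  lattice_path n s -> signed_perm n v -> signed_perm n (dB n s v).
Proof.
move=> sP vP; apply: of_window_signed_perm.
apply: perm_trans (signed_perm_window vP); rewrite /dB_window.
set mu := mu_B n s.
pose flip (j : nat) (x : int) : int :=
  if (j == n) && (2 %| mu n.-1 + mu n)%Z then - x else x.
have flipE j x : absz (flip j x) = absz x by rewrite /flip; case: ifP; lia.
have key m : perm_eq
    [seq absz x | x <- flatten
      [seq [seq flip j (v j%:Z) | j <- iota 1 n & mu j == - i%:Z] ++
           [seq flip j (- v j%:Z) | j <- rev (iota 1 n) & mu j == i%:Z + 1]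
      | i <- iota 0 m]]
    [seq absz (v j%:Z) | j <- iota 1 n & - m%:Z < mu j <= m%:Z].
  elim: m => [|m IHm].
    by rewrite (@eq_filter _ _ pred0) ?filter_pred0 // => j /=; lia.
  have -> : iota 0 m.+1 = iota 0 m ++ [:: m] by rewrite -[m.+1]addn1 iotaD.
  rewrite map_cat flatten_cat map_cat /= cats0 map_cat -!map_comp.
  apply/permP => a; rewrite !count_cat (permP IHm) filter_rev map_rev count_rev.
  rewrite !count_map !count_filter.
  elim: (iota 1 n) => //= j t IHt; rewrite !flipE abszN.
  by case: (a _) => /=; lia.
rewrite (perm_trans (key _)) //.
have /all_filterP -> // : all (fun j => - (2 * n).+1%:Z < mu j <= (2 * n).+1%:Z) (iota 1 n).
by apply/allP => j; rewrite mem_iota => jn; have := @mu_B_bound n s j sP; rewrite -/mu; lia.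
Qed.

(* Main.v *)
Require Import Defs.
From mathcomp Require Import all_boot all_order all_algebra.
From mathcomp Require Import zify.
Import GRing.Theory.
Local Open Scope ring_scope.
Set Implicit Arguments.
Unset Strict Implicit.
Unset Printing Implicit Defensive.
Import Order.TTheory Num.Theory.

(* Extend the area vector and the labels to odd functions M and V of the rows
   -n, .., n.  Then zeta_B(pi), with its deleted last letter put back, reads the
   rows from -n to n once for each level j = 2n, .., 0, writing N when M = j and
   E when M = j+1; and, counting from the start, both the k-th N and the k-th E
   come from a row r with w(n+1-k) = - V(r).

   Write e_i for the number of East steps before the i-th North step and put
   m = mu_{n-1} - 1 + 2 (e_n - e_{n-1}).  The last row carries (m, v(n)) or
   (1-m, -v(n)), the choice being decided by a parity.  Neither the sweep (up to
   its last letter) nor the window of d_B changes when the last row (x, u) is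
   replaced by (1-x, -u), because a letter written at the end of one reading is
   then written at the beginning of the next.  So one may take (m, v(n)), or
   (0, -v(n)) if m = 1.  With this choice M decreases by at most 1 from each row
   to the next, by exactly 1 precisely at the rises (and around row 0 when the
   path begins with N), and the deleted letter is N.  A discrete intermediate
   value argument then shows that an E is immediately followed by an N only when
   they come from neighbouring rows r, r+1 with M(r+1) = M(r) - 1 >= 0.  A rise i
   contributes exactly one such pair: r = i if M(i) >= 1, and r = -i-1
   otherwise. *)

Lemma iotaSr a n : iota a n.+1 = rcons (iota a n) (a + n).
Proof. by rewrite -addn1 iotaD cats1. Qed.

Lemma rev_iota0S m : rev (iota 0 m.+1) = m :: rev (iota 0 m).
Proof. by rewrite iotaSr rev_rcons. Qed.

(** * Adjacent values of a partial map along a sequence *)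

Section PartialMap.
Variables (S : eqType) (A : Type) (h : S -> option A).

Lemma pmap_flatten (ss : seq (seq S)) :
  pmap h (flatten ss) = flatten [seq pmap h s | s <- ss].
Proof. by elim: ss => //= s ss <-; rewrite pmap_cat. Qed.

Lemma pmap_eq_nil s : pmap h s = [::] -> {in s, forall t, h t = None}.
Proof.
elim: s => //= p s IHs; case hp: (h p) => [z|] //= /IHs hs t.
by rewrite inE => /predU1P[->|/hs].
Qed.

Lemma pmap_eq_cat s t1 t2 : pmap h s = t1 ++ t2 ->
  exists s1 s2, [/\ s = s1 ++ s2, pmap h s1 = t1 & pmap h s2 = t2].
Proof.
elim: s t1 => [|p s IHs] t1 /=.
  by case: t1 => // Dt2; exists [::], [::].
case hp: (h p) => [z|] /=; last first.
  by move=> /IHs[s1 [s2 [-> <- <-]]]; exists (p :: s1), s2; rewrite /= hp.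
case: t1 => [Dt2|x t1 [<- /IHs[s1 [s2 [-> <- <-]]]]].
  by exists [::], (p :: s); rewrite /= hp.
by exists (p :: s1), s2; rewrite /= hp.
Qed.

Lemma pmap_eq_cons s x t : pmap h s = x :: t ->
  exists s1 p s2, [/\ s = s1 ++ p :: s2, h p = Some x,
                      {in s1, forall u, h u = None} & pmap h s2 = t].
Proof.
elim: s => //= p s IHs; case hp: (h p) => [z|] /=.
  by case=> <- <-; exists [::], p, s.
move=> /IHs[s1 [q [s2 [-> hq hs1 <-]]]]; exists (p :: s1), q, s2; split=> //.
by move=> u; rewrite inE => /predU1P[->|/hs1].
Qed.

(** Since [s] is strictly increasing for [lt], two outputs are consecutive when no contributing
    element lies strictly between their sources. Positions are thus traded for inequalities. *)
Lemma pmap_adjacent (lt : rel S) s x y :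
    irreflexive lt -> transitive lt -> pairwise lt s ->
  (exists t1 t2, pmap h s = t1 ++ x :: y :: t2) <->
  (exists p q, [/\ p \in s, q \in s, lt p q, h p = Some x /\ h q = Some y
     & {in s, forall t, lt p t -> lt t q -> h t = None}]).
Proof.
move=> ltI ltT lt_s; split.
  move=> [t1 [t2 /pmap_eq_cat[s1 [s2 [def_s _ hs2]]]]].
  move/pmap_eq_cons: hs2 => [s3 [p [s4 [def_s2 hp hs3]]]].
  move=> /pmap_eq_cons[s5 [q [s6 [def_s4 hq hs5 _]]]].
  move: lt_s; rewrite {}def_s {}def_s2 {}def_s4.
  rewrite catA; move: (s1 ++ s3) => {hs3}s1 lt_s.
  exists p, q; split=> //; rewrite ?(mem_cat, inE, eqxx, orbT) //.
    move: lt_s; rewrite pairwise_cat /= => /and3P[_ _ /andP[/allP + _]].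
    by apply; rewrite mem_cat inE eqxx orbT.
  move=> t; rewrite mem_cat inE mem_cat inE => ts ptr ttq.
  move: lt_s; rewrite pairwise_cat allrel_consr /= pairwise_cat /= allrel_consr.
  case/and3P=> /andP[/allP s1p _] _ /and3P[_ /andP[_ _] /and3P[_ /allP qs6 _]].
  case/or4P: ts => [/s1p tp|/eqP tp|/hs5 //|/orP[/eqP tq|/qs6 qt]].
  - by have := ltT _ _ _ ptr tp; rewrite ltI.
  - by rewrite tp ltI in ptr.
  - by rewrite tq ltI in ttq.
  - by have := ltT _ _ _ ttq qt; rewrite ltI.
move=> [p [q [ps qs pq [hp hq] none]]].
case/splitPr: ps lt_s qs none => s1 s2 lt_s.
rewrite mem_cat inE => qs none.
have {qs} qs2 : q \in s2.
  case/or3P: qs => [q1|/eqP qp|//]; last by rewrite qp ltI in pq.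
  move: lt_s; rewrite pairwise_cat allrel_consr => /andP[/andP[/allP/(_ _ q1) qp _] _].
  by have := ltT _ _ _ pq qp; rewrite ltI.
case/splitPr: qs2 lt_s none => s3 s4.
rewrite pairwise_cat /= pairwise_cat /= !allrel_consr all_cat /=.
case/and3P=> _ _ /andP[/and3P[/allP ps3 _ _] /andP[/andP[/allP s3q _] _]] none.
have hs3 : pmap h s3 = [::].
  have : {in s3, forall t, h t = None}.
    by move=> t ts3; apply: none (ps3 t ts3) (s3q t ts3);
       rewrite mem_cat inE mem_cat ts3 !orbT.
  elim: (s3) => //= u s' IH hs; rewrite hs ?inE ?eqxx //= IH // => t ts.
  by rewrite hs // inE ts orbT.
by exists (pmap h s1), (pmap h s4); rewrite pmap_cat /= hp /= pmap_cat hs3 /= hq.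
Qed.

End PartialMap.

(** * Sweeping the rows *)

(** The sign factor discards [f 0], so row 0 always has height 0; it supplies the N that zeta_B puts
    before the last word. *)
Definition oddify (f : nat -> int) (r : int) : int := sgz r * f (absz r).

Lemma oddify0 f : oddify f 0 = 0.
Proof. by rewrite /oddify mul0r. Qed.

Lemma oddifyN f r : oddify f (- r) = - oddify f r.
Proof. by rewrite /oddify sgzN abszN mulNr. Qed.

Lemma oddify_nat f i : (0 < i)%N -> oddify f i%:Z = f i.
Proof. by case: i => // i _; rewrite /oddify mul1r. Qed.

Fixpoint rows (n : nat) : seq int :=
  if n is k.+1 then - k.+1%:Z :: rcons (rows k) k.+1%:Z else [:: 0].

Lemma rowsE n :
  rows n = [seq - i%:Z | i <- rev (iota 1 n)] ++ 0 :: [seq i%:Z | i <- iota 1 n].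
Proof.
elim: n => // n IHn; rewrite [rows _]/= IHn.
by rewrite iotaSr rev_rcons !map_rcons /= rcons_cat.
Qed.

Lemma mem_rows n r : (r \in rows n) = (- n%:Z <= r <= n%:Z).
Proof. by elim: n => [|n IHn] /=; rewrite inE ?mem_rcons ?inE ?IHn; lia. Qed.

Lemma pairwise_rows n : pairwise <%R (rows n).
Proof.
elim: n => //= n IHn; rewrite all_rcons pairwise_rcons IHn andbT.
apply/andP; split; last by apply/allP => r; rewrite mem_rows; lia.
by apply/andP; split; [lia | apply/allP => r; rewrite mem_rows; lia].
Qed.

Definition level_step (j : nat) (x : int) : option step :=
  if x == j%:Z then Some North
  else if x == j%:Z + 1 then Some East else None.

Definition sweep (mu : nat -> int) (n m : nat) : seq step :=
  flatten [seq pmap (fun r => level_step j (oddify mu r)) (rows n)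
          | j <- rev (iota 0 m)].

Lemma pmap_map A B C (f : A -> B) (g : B -> option C) s :
  pmap g (map f s) = pmap (g \o f) s.
Proof. by elim: s => //= x s ->. Qed.

Lemma pmap_rows n j mu :
  pmap (fun r => level_step j (oddify mu r)) (rows n) =
  Sleft_neg j [seq mu i | i <- iota 1 n] ++
  (if j == 0%N then [:: North] else [::]) ++
  Sright_pos j [seq mu i | i <- iota 1 n].
Proof.
rewrite rowsE pmap_cat /= /Sleft_neg /Sright_pos /read_word -map_rev !pmap_map.
congr (_ ++ _).
  apply: eq_in_pmap => i; rewrite mem_rev mem_iota => i_n /=.
  rewrite oddifyN oddify_nat; last by lia.
  by rewrite /level_step eqr_oppLR; case: ifP => //; case: ifP; case: ifP => //; lia.
set a := pmap _ (iota 1 n); set b := pmap _ (iota 1 n).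
have -> : a = b.
  apply: eq_in_pmap => i; rewrite mem_iota => i_n /=.
  by rewrite oddify_nat //; lia.
rewrite oddify0 /level_step eq_sym eqz_nat.
have -> : (0 == j%:Z + 1) = false by lia.
by case: (_ == _).
Qed.

Lemma zeta_path_sweep n s :
  exists l, rcons (zeta_path n s) l = sweep (mu_B n s) n (2 * n).+1.
Proof.
(* The letter removed by [belast], which is the added N itself when [Sright_pos 0] is empty. *)
exists (last North (Sright_pos 0 (area_vector n s))).
rewrite /zeta_path /sweep -!cats1 -!catA cats1 -lastI.
have -> : iota 0 (2 * n).+1 = 0%N :: iota 1 (2 * n) by [].
rewrite rev_cons map_rcons flatten_rcons pmap_rows; congr (flatten _ ++ _).
apply/eq_in_map => j; rewrite mem_rev mem_iota pmap_rows => j_n.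
by case: eqP => [jn|_] //; lia.
Qed.

(** * Reflecting the last row *)

Definition level_word (j : nat) (x : int) : seq step :=
  pmap (level_step j) [:: x].

Lemma level_wordS j x : level_word j.+1 x = level_word j (x - 1).
Proof.
rewrite /level_word /= /level_step.
have -> : (x == j.+1%:Z) = (x - 1 == j%:Z) by lia.
by have -> : (x == j.+1%:Z + 1) = (x - 1 == j%:Z + 1) by lia.
Qed.

Lemma level_word_out j x : x != j%:Z -> x != j%:Z + 1 -> level_word j x = [::].
Proof. by rewrite /level_word /= /level_step => /negbTE-> /negbTE->. Qed.

Lemma sweepS mu n m :
  sweep mu n m.+1 = pmap (fun r => level_step m (oddify mu r)) (rows n) ++ sweep mu n m.
Proof. by rewrite /sweep rev_iota0S. Qed.

Lemma pmap_rowsS mu n j :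
  pmap (fun r => level_step j (oddify mu r)) (rows n.+1) =
  level_word j (- mu n.+1) ++
  pmap (fun r => level_step j (oddify mu r)) (rows n) ++ level_word j (mu n.+1).
Proof.
have -> : rows n.+1 = [:: - n.+1%:Z] ++ rows n ++ [:: n.+1%:Z].
  by rewrite cats1.
by rewrite !pmap_cat /level_word /= oddifyN !oddify_nat.
Qed.

(* The letter of the last row at level m+1, which the sweep from level m does not
   contain, has to be carried along: reflection exchanges it with the first letter
   of the reading at level m. *)
Lemma sweep_reflect_aux (mu mu' : nat -> int) n m :
    {in iota 1 n, mu =1 mu'} -> mu' n.+1 = 1 - mu n.+1 ->
  exists t l l',
    level_word m.+1 (mu n.+1) ++ sweep mu n.+1 m.+1 = rcons t l /\
    level_word m.+1 (mu' n.+1) ++ sweep mu' n.+1 m.+1 = rcons t l'.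
Proof.
move=> mumu' mu'n; pose mid j := pmap (fun r => level_step j (oddify mu r)) (rows n).
have mid' j : pmap (fun r => level_step j (oddify mu' r)) (rows n) = mid j.
  rewrite /mid !pmap_rows; have -> // : map mu' (iota 1 n) = map mu (iota 1 n).
  by apply/eq_in_map => i /mumu' ->.
pose x := mu n.+1; pose p j := level_word j.+1 x ++ level_word j (- x) ++ mid j.
(* The two words commute because one is empty: the first needs x > 0, the second x <= 0. *)
have pE j : level_word j.+1 x ++ level_word j (- x) =
            level_word j (- x) ++ level_word j.+1 x.
  have [xj|xj] := leP x 0.
    by rewrite (@level_word_out j.+1 x) ?cats0 //; lia.
  by rewrite (@level_word_out j (- x)) ?cats0 //; lia.
have step j : level_word j.+1 (mu n.+1) ++ sweep mu n.+1 j.+1 =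
    p j ++ level_word j x ++ sweep mu n.+1 j.
  by rewrite sweepS pmap_rowsS /p -!catA.
have step' j : level_word j.+1 (mu' n.+1) ++ sweep mu' n.+1 j.+1 =
    p j ++ level_word j (1 - x) ++ sweep mu' n.+1 j.
  rewrite sweepS pmap_rowsS mid' mu'n /p !catA pE level_wordS.
  rewrite (level_wordS j x).
  have -> : 1 - mu n.+1 - 1 = - x by lia.
  by have -> : - (1 - mu n.+1) = x - 1 by lia.
elim: m => [|m [t [l [l' [IH IH']]]]]; last first.
  exists (p m.+1 ++ t), l, l'.
  by rewrite step IH step' -mu'n IH' -!rcons_cat.
rewrite step step' /sweep /= !cats0.
(* Below level 0 nothing absorbs the carried letter. It exists only for x = 0 or 1, and is then the
   last letter, the one allowed to differ. *)
have [x0|x0] : (x == 0 \/ x == 1) \/ (x != 0 /\ x != 1) by lia.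
  have [a xa] : exists a, level_word 0 x = [:: a].
    rewrite /level_word /= /level_step.
    by case: x0 => /eqP->; [exists North | exists East].
  have [b xb] : exists b, level_word 0 (1 - x) = [:: b].
    rewrite /level_word /= /level_step.
    by case: x0 => /eqP->; [exists East | exists North].
  by exists (p 0%N), a, b; rewrite xa xb !cats1.
rewrite !level_word_out; try by lia.
rewrite !cats0.
(* Row 0 writes an N at level 0. *)
have : p 0%N != [::].
  by rewrite -size_eq0 /p /mid pmap_rows !size_cat /=; lia.
by case/lastP: (p 0%N) => // t l _; exists t, l, l.
Qed.

(** The bounds on the last height make the letter carried in from level m+1 empty on both sides. *)
Lemma sweep_reflect (mu mu' : nat -> int) n m :
    {in iota 1 n, mu =1 mu'} -> mu' n.+1 = 1 - mu n.+1 ->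
    - m%:Z < mu n.+1 <= m%:Z ->
  exists t l l', sweep mu n.+1 m.+1 = rcons t l /\ sweep mu' n.+1 m.+1 = rcons t l'.
Proof.
move=> mumu' mu'n mun.
have [t [l [l' [E E']]]] := sweep_reflect_aux m mumu' mu'n.
by exists t, l, l'; rewrite -E -E' !level_word_out //; lia.
Qed.

Definition window (n : nat) (mu c : nat -> int) (m : nat) : seq int :=
  flatten [seq [seq c j | j <- iota 1 n & mu j == - i%:Z] ++
               [seq - c j | j <- rev (iota 1 n) & mu j == i%:Z + 1]
          | i <- iota 0 m].

Lemma dB_window_window n s v :
  dB_window n s v =
  window n (mu_B n s)
    (fun j => if (j == n) && (2 %| mu_B n s n.-1 + mu_B n s n)%Z
              then - v j%:Z else v j%:Z) (2 * n).+1.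
Proof.
rewrite /dB_window /window; congr flatten; apply: eq_map => i.
by congr (_ ++ _); apply: eq_map => j; case: ifP.
Qed.

(** The last row comes last in the increasing list of its level and first in the decreasing one.
    These positions are adjacent, and the sign in the second list cancels that of the reflected
    label. *)
Lemma window_reflect (mu mu' c c' : nat -> int) n m :
    {in iota 1 n, mu =1 mu'} -> mu' n.+1 = 1 - mu n.+1 ->
    {in iota 1 n, c =1 c'} -> c' n.+1 = - c n.+1 ->
  window n.+1 mu c m = window n.+1 mu' c' m.
Proof.
move=> mumu' mu'n cc' c'n; rewrite /window; congr flatten; apply: eq_map => i.
rewrite iotaSr !filter_rcons rev_rcons /= mu'n.
have -> : (1 - mu n.+1 == - i%:Z) = (mu n.+1 == i%:Z + 1) by lia.
have -> : (1 - mu n.+1 == i%:Z + 1) = (mu n.+1 == - i%:Z) by lia.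
have -> : [seq j <- iota 1 n | mu j == - i%:Z] = [seq j <- iota 1 n | mu' j == - i%:Z].
  by apply: eq_in_filter => j /mumu' ->.
have -> : [seq j <- rev (iota 1 n) | mu j == i%:Z + 1]
    = [seq j <- rev (iota 1 n) | mu' j == i%:Z + 1].
  by apply: eq_in_filter => j; rewrite mem_rev => /mumu' ->.
set a := filter _ _; set b := filter _ _.
have ca : map c a = map c' a.
  by apply/eq_in_map => j; rewrite mem_filter => /andP[_ /cc'].
have cb : map (fun j => - c j) b = map (fun j => - c' j) b.
  by apply/eq_in_map => j; rewrite mem_filter mem_rev => /andP[_ /cc' ->].
case: eqP => [x1|_]; case: eqP => [x2|_]; first by lia.
- by rewrite /= map_rcons ca cb c'n opprK cat_rcons.
- by rewrite map_rcons /= ca cb c'n cat_rcons.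
- by rewrite ca cb.
Qed.

(** * Valley labels *)

Section Tags.
Variables (n : nat) (mu c : nat -> int).

Definition tagged_step (j : nat) (r : int) : option (step * int) :=
  omap (pair^~ (- oddify c r)) (level_step j (oddify mu r)).

Definition tagged_sweep (m : nat) : seq (step * int) :=
  flatten [seq pmap (tagged_step j) (rows n) | j <- rev (iota 0 m)].

Definition tags (x : step) (t : seq (step * int)) : seq int :=
  [seq u.2 | u <- t & u.1 == x].

(** Row -i has height -mu(i) and tag c(i), whence the opposite signs here and in [pos_tags]; the
    reversal is the order of the negative rows. *)
Definition neg_tags (l : int) : seq int :=
  [seq c i | i <- rev (iota 1 n) & mu i == - l].

Definition pos_tags (l : int) : seq int :=
  [seq - c i | i <- iota 1 n & mu i == l].

Definition level_tags (l : int) : seq int :=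
  [seq - oddify c r | r <- rows n & oddify mu r == l].

Lemma tags_cat x t1 t2 : tags x (t1 ++ t2) = tags x t1 ++ tags x t2.
Proof. by rewrite /tags filter_cat map_cat. Qed.

Lemma size_tags x t : size (tags x t) = count_mem x (map fst t).
Proof. by rewrite size_map size_filter count_map. Qed.

Lemma tagged_sweepS m :
  tagged_sweep m.+1 = pmap (tagged_step m) (rows n) ++ tagged_sweep m.
Proof. by rewrite /tagged_sweep rev_iota0S. Qed.

Lemma fst_tagged_sweep m : map fst (tagged_sweep m) = sweep mu n m.
Proof.
elim: m => // m IHm; rewrite tagged_sweepS sweepS map_cat IHm; congr (_ ++ _).
by elim: (rows n) => //= r s <-; rewrite /tagged_step; case: (level_step _ _).
Qed.

Lemma tags_North_row j :
  tags North (pmap (tagged_step j) (rows n)) = level_tags j%:Z.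
Proof.
rewrite /level_tags; elim: (rows n) => //= r s IHs.
rewrite [tagged_step j r]/tagged_step /level_step /=.
case: eqP => [_|_] /=; first by rewrite -IHs.
by case: eqP => _ //=.
Qed.

Lemma tags_East_row j :
  tags East (pmap (tagged_step j) (rows n)) = level_tags (j%:Z + 1).
Proof.
rewrite /level_tags; elim: (rows n) => //= r s IHs.
rewrite [tagged_step j r]/tagged_step /level_step /=.
case: (eqVneq (oddify mu r) j%:Z) => [->|_] /=.
  by have -> : (j%:Z == j%:Z + 1) = false by lia.
by case: eqP => [_|_] //=; rewrite -IHs.
Qed.

Lemma level_tagsE l :
  level_tags l = neg_tags l ++ (if l == 0 then [:: 0] else [::]) ++ pos_tags l.
Proof.
rewrite /level_tags rowsE filter_cat map_cat /=; congr (_ ++ _).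
  rewrite filter_map -map_comp /neg_tags.
  have -> : [seq i <- rev (iota 1 n) | preim (fun i : nat => - i%:Z)
               (fun r => oddify mu r == l) i] =
            [seq i <- rev (iota 1 n) | mu i == - l].
    apply: eq_in_filter => i; rewrite mem_rev mem_iota => i_n /=.
    by rewrite oddifyN oddify_nat; lia.
  apply/eq_in_map => i; rewrite mem_filter mem_rev mem_iota => /andP[_ i_n] /=.
  by rewrite oddifyN oddify_nat ?opprK; lia.
have E : [seq - oddify c r | r <- [seq i%:Z | i <- iota 1 n] & oddify mu r == l] =
    pos_tags l.
  rewrite filter_map -map_comp /pos_tags.
  have -> : [seq i <- iota 1 n | preim Posz (fun r => oddify mu r == l) i] =
            [seq i <- iota 1 n | mu i == l].
    by apply: eq_in_filter => i; rewrite mem_iota => i_n /=; rewrite oddify_nat; lia.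
  apply/eq_in_map => i; rewrite mem_filter mem_iota => /andP[_ i_n] /=.
  by rewrite oddify_nat; lia.
by rewrite oddify0 eq_sym; case: eqP => //= _; rewrite E ?oddify0 ?oppr0.
Qed.

Lemma windowS m :
  window n mu c m.+1 = window n mu c m ++
    [seq c j | j <- iota 1 n & mu j == - m%:Z] ++
    [seq - c j | j <- rev (iota 1 n) & mu j == m%:Z + 1].
Proof. by rewrite /window iotaSr map_rcons flatten_rcons. Qed.

Lemma rev_windowS m :
  rev (window n mu c m.+1) =
  pos_tags (m%:Z + 1) ++ neg_tags m%:Z ++ rev (window n mu c m).
Proof.
by rewrite windowS !rev_cat -catA -!map_rev -!filter_rev revK.
Qed.

(* The next two lemmas say that the labels of the North steps, and those of the East
   steps, are initial segments of the sequence w(n), .., w(1), 0, w(-1), .., w(-n). *)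
Lemma rev_window_North m :
  rev (window n mu c m.+1) ++ 0 :: pos_tags 0 =
  pos_tags (m%:Z + 1) ++ tags North (tagged_sweep m.+1).
Proof.
elim: m => [|m IHm]; rewrite rev_windowS tagged_sweepS tags_cat tags_North_row.
  by rewrite level_tagsE eqxx /= !cats0 -!catA.
by rewrite level_tagsE /= -!catA IHm /= -addn1 PoszD.
Qed.

Lemma rev_window_East m :
  neg_tags (m%:Z + 1) ++ rev (window n mu c m.+1) =
  tags East (tagged_sweep m.+1) ++ neg_tags 0.
Proof.
elim: m => [|m IHm]; rewrite rev_windowS tagged_sweepS tags_cat tags_East_row.
  by rewrite level_tagsE /= !cats0 -!catA.
rewrite level_tagsE -!catA -IHm.
by have -> : m.+1%:Z = m%:Z + 1 by lia.
Qed.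

(** The window starts with the rows of height 0 in increasing order, so w(-1), w(-2), .. starts with
    the tags of the N's written after row 0 at level 0. *)
Lemma opp_window m :
  exists t, map -%R (window n mu c m.+1) = pos_tags 0 ++ t.
Proof.
rewrite /window /= oppr0 !map_cat -!map_comp -!catA /pos_tags.
by eexists.
Qed.

Lemma size_window m :
  size (window n mu c m) = count (fun j => - m%:Z < mu j <= m%:Z) (iota 1 n).
Proof.
elim: m => [|m IHm].
  by rewrite (@eq_count _ _ pred0) ?count_pred0 // => j /=; lia.
rewrite windowS !size_cat IHm !size_map filter_rev size_rev !size_filter.
by elim: (iota 1 n) => //= j t <-; lia.
Qed.

(** Indices into w(n), .., w(1), 0, w(-1), .., w(-n) start from 0, so the valley label w(n+1-i) sits
    at k = i-1. *)
Lemma of_window_center (w : seq int) k : size w = n -> (k <= 2 * n)%N ->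
  of_window w (n%:Z - k%:Z) = (rev w ++ 0 :: map -%R w)`_k.
Proof.
move=> sw k2n; rewrite nth_cat size_rev sw.
case: ltnP => [kn|nk].
  have -> : n%:Z - k%:Z = (n - k.+1).+1%:Z by lia.
  rewrite /= nth_rev ?sw //.
case: (posnP (k - n)) => [kn|nk'].
  have -> : n%:Z - k%:Z = 0 by lia.
  by rewrite kn.
have -> : n%:Z - k%:Z = Negz (k - n).-1 by lia.
rewrite -(prednK nk') /= (nth_map 0) // sw; lia.
Qed.

End Tags.

Lemma onth_Some_split (A : Type) (s : seq A) p x :
  onth s p = Some x -> exists s1 s2, s = s1 ++ x :: s2 /\ size s1 = p.
Proof.
elim: s p => [|y s IHs] [|p] //=; first by case=> ->; exists [::], s.
by case/IHs => s1 [s2 [-> <-]]; exists (y :: s1), s2.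
Qed.

(* Appending a North step absorbs the convention for words ending in East. *)
Lemma valleyP s i j :
  valley s i j <-> exists t1 t2, [/\ rcons s North = t1 ++ East :: North :: t2,
    i = (count_mem East t1).+1 & j = (count_mem North t1).+1].
Proof.
have take_size (s1 s2 : seq step) x :
    take (size s1).+1 (s1 ++ x :: s2) = rcons s1 x.
  by rewrite -cat_rcons -(size_rcons s1 x) take_size_cat.
split.
  case=> [[p /andP[/andP[/eqP Ep /eqP <-] /andP[/eqP Np /eqP <-]]]|[ls <- <-]].
    have [s1 [s2 [def_s def_p]]] := onth_Some_split Ep.
    move: Np; rewrite def_s -def_p onth_cat ltnNge leqnSn subSnn /=.
    case: s2 {Ep} def_s => // x s2 def_s [Dx]; rewrite Dx in def_s *.
    exists s1, (rcons s2 North); rewrite rcons_cat take_size; split=> //.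
      by rewrite -cats1 count_cat /= addn0 addn1.
    rewrite -cat_rcons -(size_rcons s1 East) take_size -!cats1 !count_cat /=.
    by rewrite !addn0 addn1.
  case/lastP: s ls => // s x; rewrite last_rcons => ->.
  exists s, [::]; rewrite -!cats1 -catA; split=> //; rewrite count_cat /=; lia.
case=> t1 [t2 [E -> ->]]; case/lastP: t2 E => [|t2 x] E; last first.
  have E' : rcons s North = rcons (t1 ++ East :: North :: t2) x by rewrite E rcons_cat.
  have [-> _] := rcons_inj E'.
  left; exists (size t1); rewrite /ith_step !onth_cat ltnn subnn ltnNge leqnSn subSnn !eqxx.
  rewrite take_size.
  rewrite -cat_rcons -(size_rcons t1 East) take_size -!cats1 !count_cat /=.
  by rewrite !addn0 !addn1 !eqxx.
right; have -> : s = rcons t1 East.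
  by apply: (@rcons_injl _ North); rewrite E -!cats1 -catA.
by rewrite last_rcons -cats1 !count_cat /=; split=> //; lia.
Qed.

(** The deleted letter is the N appended in [valleyP], so valleys are the factors EN of the full
    sweep. Their labels are the tags, since the tags of either letter form a prefix of [L]. *)
Lemma has_valley_tagged n mu c s a b :
    {in iota 1 n, forall i, - (2 * n%:Z) <= mu i <= 2 * n%:Z} ->
    rcons s North = sweep mu n (2 * n).+1 ->
  has_valley n (s, of_window (window n mu c (2 * n).+1)) a b <->
  exists t1 t2,
    tagged_sweep n mu c (2 * n).+1 = t1 ++ (East, a) :: (North, b) :: t2.
Proof.
move=> mu_n s_sweep; set w := window _ _ _ _; set T := tagged_sweep _ _ _ _.
have szw : size w = n.
  rewrite size_window -[RHS](size_iota 1 n); apply/eqP; rewrite -all_count.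
  by apply/allP => i /mu_n; lia.
have fstT : map fst T = rcons s North by rewrite fst_tagged_sweep.
pose L := rev w ++ 0 :: map -%R w.
(* No row has height 2n+1 or -2n-1, so the boundary terms of [rev_window_East] and
   [rev_window_North] vanish at the top level. *)
have neg0 : neg_tags n mu c ((2 * n)%:Z + 1) = [::].
  rewrite /neg_tags (@eq_in_filter _ _ pred0) ?filter_pred0 // => i.
  by rewrite mem_rev => /mu_n /=; lia.
have pos0 : pos_tags n mu c ((2 * n)%:Z + 1) = [::].
  by rewrite /pos_tags (@eq_in_filter _ _ pred0) ?filter_pred0 // => i /mu_n /=; lia.
have [LN defLN] : exists t, L = tags North T ++ t.
  have := rev_window_North n mu c (2 * n); rewrite pos0 cat0s -/w -/T.
  have [t wt] := opp_window n mu c (2 * n); move: wt; rewrite -/w /L => ->.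
  by rewrite -cat_cons catA => ->; exists t.
have [LE defLE] : exists t, L = tags East T ++ t.
  have := rev_window_East n mu c (2 * n); rewrite neg0 cat0s -/w -/T /L => ->.
  by rewrite -catA; eexists.
have tag x t1 y t2 : (exists t, L = tags x T ++ t) -> T = t1 ++ (x, y) :: t2 ->
    of_window w (n%:Z + 1 - (count_mem x (map fst t1)).+1%:Z) = y.
  move=> [t defL] defT; have -> : n%:Z + 1 - (count_mem x (map fst t1)).+1%:Z =
    n%:Z - (count_mem x (map fst t1))%:Z by lia.
  rewrite of_window_center //; last first.
    have := congr1 size defL; rewrite !size_cat size_rev /= size_map szw size_tags defT.
    rewrite map_cat count_cat /= eqxx; lia.
  rewrite -/L defL defT tags_cat -size_tags /tags /= eqxx /= -catA nth_cat.
  by rewrite ltnn subnn.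
have tags2 t1 a' b' t2 : T = t1 ++ (East, a') :: (North, b') :: t2 ->
    of_window w (n%:Z + 1 - (count_mem East (map fst t1)).+1%:Z) = a' /\
    of_window w (n%:Z + 1 - (count_mem North (map fst t1)).+1%:Z) = b'.
  move=> defT; split; first by apply: tag defT; exists LE.
  have := tag North (rcons t1 (East, a')) b' t2.
  rewrite map_rcons -!cats1 count_cat /= !addn0; apply; first by exists LN.
  by rewrite defT -catA.
split.
  case=> i [j [/valleyP[t1 [t2 [E -> ->]]] /= [<- <-]]].
  have defT : T = take (size t1) T ++ drop (size t1) T by rewrite cat_take_drop.
  have t1E : map fst (take (size t1) T) = t1 by rewrite map_take fstT E take_size_cat.
  have : map fst (drop (size t1) T) = [:: East, North & t2].
    by rewrite map_drop fstT E drop_size_cat.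
  case: (drop _ _) defT => [|[x a'] [|[y b'] t]] //= defT [Ex Ey _]; subst x y.
  have := tags2 _ _ _ _ defT; rewrite t1E => -[-> ->].
  by exists (take (size t1) T), t.
case=> t1 [t2 defT].
exists (count_mem East (map fst t1)).+1, (count_mem North (map fst t1)).+1; split.
  apply/valleyP; exists (map fst t1), (map fst t2); split=> //.
  by rewrite -fstT defT map_cat.
by have [/= -> ->] := tags2 _ _ _ _ defT.
Qed.

(** * Adjacent letters of the sweep *)

(** Falling by at most 1 per step, [f] cannot skip a value on its way down, although it may jump up
    freely. *)
Lemma discrete_ivt (f : int -> int) (a b k : int) :
    a <= b -> (forall r, a <= r < b -> f r - 1 <= f (r + 1)) ->
    k <= f a -> f b <= k ->
  exists2 t, a <= t <= b & f t = k.
Proof.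
move=> ab; have [d ->] : exists d : nat, b = a + d%:Z by exists (absz (b - a)); lia.
elim: d a {ab} => [|d IHd] a f_step fa fb.
  by exists a; rewrite ?addr0 in fb *; lia.
have [fak|fak] := eqVneq (f a) k; first by exists a; lia.
have := f_step a; rewrite lexx /= => /(_ _) f_a.
have [|||t ? <-] := IHd (a + 1).
- by move=> r r_ad; apply: f_step; lia.
- by have := f_a; lia.
- by move: fb; have -> : a + d.+1%:Z = a + 1 + d%:Z by lia.
by exists t; lia.
Qed.

Lemma level_step_North j x : (level_step j x == Some North) = (x == j%:Z).
Proof. by rewrite /level_step; case: (x =P _) => // _; case: (x =P _). Qed.

Lemma level_step_East j x : (level_step j x == Some East) = (x == j%:Z + 1).
Proof.
rewrite /level_step; case: (x =P j%:Z) => [->|_]; last by case: (x =P _).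
by apply/esym/negbTE; lia.
Qed.

Lemma level_step_None j x :
  (level_step j x == None) = (x != j%:Z) && (x != j%:Z + 1).
Proof. by rewrite /level_step; case: (x =P _) => // _; case: (x =P _). Qed.

(** The pairs (level, row) in reading order, so that [pmap_adjacent] applies to the whole sweep with
    [slot_lt]. *)
Definition slots (n m : nat) : seq (nat * int) :=
  flatten [seq [seq (j, r) | r <- rows n] | j <- rev (iota 0 m)].

Definition slot_lt (p q : nat * int) : bool :=
  (q.1 < p.1)%N || (p.1 == q.1) && (p.2 < q.2).

Lemma mem_slots n m p : (p \in slots n m) = (p.1 < m)%N && (- n%:Z <= p.2 <= n%:Z).
Proof.
case: p => j r; apply/flatten_mapP/idP => [[i i_m /mapP[t t_n [-> ->]]]|/andP[jm rn]].
  by rewrite mem_rev mem_iota mem_rows in i_m t_n; rewrite /=; lia.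
by exists j; [rewrite mem_rev mem_iota | apply: map_f; rewrite mem_rows].
Qed.

Lemma pairwise_slots n m : pairwise slot_lt (slots n m).
Proof.
elim: m => // m IHm; rewrite /slots rev_iota0S [flatten _]/= -/(slots n m).
rewrite pairwise_cat IHm andbT pairwise_map; apply/andP; split.
  apply/allrelP => p q /mapP[r _ ->]; rewrite mem_slots /slot_lt /=; lia.
apply: sub_pairwise (pairwise_rows n) => r t.
by rewrite /slot_lt /= ltnn eqxx.
Qed.

Lemma slot_lt_irr : irreflexive slot_lt.
Proof. by move=> p; rewrite /slot_lt; lia. Qed.

Lemma slot_lt_trans : transitive slot_lt.
Proof. by move=> p q r; rewrite /slot_lt; lia. Qed.

Lemma tagged_sweep_slots n mu c m :
  tagged_sweep n mu c m = pmap (fun p => tagged_step mu c p.1 p.2) (slots n m).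
Proof.
rewrite pmap_flatten -map_comp /tagged_sweep; congr flatten.
by apply: eq_map => j /=; rewrite pmap_map.
Qed.

Section Adjacent.
Variables (n : nat) (mu c : nat -> int).
Let M := oddify mu.
Let V := oddify c.
Hypothesis n_gt0 : (0 < n)%N.
Hypothesis mu_bound : forall i, (0 < i <= n)%N -> - (2 * n%:Z) <= mu i <= 2 * n%:Z.
Hypothesis M_descent : forall i : nat, (i < n)%N -> M i%:Z - 1 <= M i.+1%:Z.
(** These bounds control the passage from one reading to the next. The second amounts to M(-n+1) >=
    M(n) - 1, a descent condition across levels; the last keeps row n from writing E at level 0. *)
Hypothesis M_pred_le1 : M (n%:Z - 1) <= 1.
Hypothesis M_last2_le1 : M (n%:Z - 1) + M n%:Z <= 1.
Hypothesis M_last_neq1 : M n%:Z != 1.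

(** Oddness turns the descent condition at i into the one at -i-1. *)
Lemma M_step (r : int) : - n%:Z <= r < n%:Z -> M r - 1 <= M (r + 1).
Proof.
move=> rn; have [r0|r0] := leP 0 r.
  have [i ri] : exists i : nat, r = i%:Z by exists (absz r); lia.
  have -> : r + 1 = i.+1%:Z by lia.
  by rewrite ri; apply: M_descent; lia.
have [i ri] : exists i : nat, r + 1 = - i%:Z by exists (absz (r + 1)); lia.
rewrite ri; have -> : r = - i.+1%:Z by lia.
rewrite /M !oddifyN -/M.
by have := @M_descent i; lia.
Qed.

Lemma M_bound (r : int) : - n%:Z <= r <= n%:Z -> - (2 * n%:Z) <= M r <= 2 * n%:Z.
Proof.
move=> rn; case: (ltrgtP r 0) => r0.
- have -> : r = - (absz r)%:Z by lia.
  by rewrite /M oddifyN oddify_nat; [have := @mu_bound (absz r); lia | lia].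
- have -> : r = (absz r)%:Z by lia.
  by rewrite /M oddify_nat; [have := @mu_bound (absz r); lia | lia].
- by rewrite r0 /M oddify0; lia.
Qed.

Lemma M0 : M 0 = 0. Proof. exact: oddify0. Qed.

(** Suppose row r wrote a final E, so M(r) = 1. If r = n-1, the bounds force M(n) = 0 and an N
    follows. If r < n-1, either row r+1 writes a letter or M(r+1) >= 2, and M takes the value 1
    again by row n-1. *)
Lemma sweep_last m : exists s, sweep mu n m.+1 = rcons s North.
Proof.
have [t [x E]] : exists t x, pmap (fun r => level_step 0 (M r)) (rows n) = rcons t x.
  set w := pmap _ _; have : w != [::].
    by rewrite -size_eq0 /w pmap_rows !size_cat /=; lia.
  by move: w => w; case/lastP: w => // t x _; exists t, x.
have -> : North = x.
  have [r [rn Mr none]] : exists r : int, [/\ - n%:Z <= r <= n%:Z,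
      level_step 0 (M r) = Some x &
      forall u : int, r < u <= n%:Z -> level_step 0 (M u) = None].
    rewrite -cats1 in E; have [s1 [s2 [defr _ E2]]] := pmap_eq_cat E.
    have [s3 [r [s4 [defs2 Mr _ E4]]]] := pmap_eq_cons E2.
    have /andP[nr rn] : - n%:Z <= r <= n%:Z.
      by rewrite -mem_rows defr defs2 !mem_cat inE eqxx !orbT.
    exists r; split=> // [|u un]; first by rewrite nr.
    have : u \in rows n.
      by rewrite mem_rows; case/andP: un => /ltW/(le_trans nr)->.
    have := pairwise_rows n; rewrite defr defs2 catA pairwise_cat allrel_consr.
    case/and3P=> /andP[/allP lt_r _] _ _; rewrite mem_cat inE.
    case/andP: un => ru _; case/or3P=> [/lt_r/(lt_trans ru)|/eqP ur|/(pmap_eq_nil E4)//].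
      by rewrite ltxx.
    by rewrite ur ltxx in ru.
  case: x {E} Mr => // /eqP; rewrite level_step_East => /eqP Mr.
  have {}none (u : int) : r < u <= n%:Z -> M u != 0 /\ M u != 1.
    by move/none/eqP; rewrite level_step_None => /andP[].
  have [rE|r_n] := eqVneq r n%:Z; first by move: M_last_neq1; rewrite -rE Mr.
  have M1 := @M_step r; have N1 := none (r + 1).
  have [rE|r_n1] := eqVneq r (n%:Z - 1).
    by move: M1 N1 M_last2_le1; rewrite rE subrK -rE Mr; lia.
  have [||||u un Mu] := @discrete_ivt M (r + 1) (n%:Z - 1) 1; try lia.
    by move=> u un; apply: M_step; lia.
  by have := none u; lia.
have -> : sweep mu n m.+1 = flatten [seq pmap (fun r => level_step j (M r)) (rows n)
          | j <- rev (iota 1 m)] ++ rcons t x.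
  by rewrite -E /sweep /= rev_cons map_rcons flatten_rcons.
by rewrite -rcons_cat; eexists.
Qed.

Lemma tagged_sweep_adjacent a b :
  (exists t1 t2,
    tagged_sweep n mu c (2 * n).+1 = t1 ++ (East, a) :: (North, b) :: t2) <->
  (exists r, [/\ - n%:Z <= r < n%:Z, M (r + 1) = M r - 1, 1 <= M r,
                 a = - V r & b = - V (r + 1)]).
Proof.
rewrite tagged_sweep_slots.
rewrite (pmap_adjacent _ _ _ slot_lt_irr slot_lt_trans (pairwise_slots _ _)); split.
  move=> [[j r] [[j' s] [/= pn qn lt_pq [hp hq] none]]].
  move: j r j' s pn qn lt_pq hp hq none => j r j' s.
  rewrite !mem_slots /= => pn qn lt_pq hp hq none.
  have {hp} [Mr Va] : M r = j%:Z + 1 /\ a = - V r.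
    move: hp; rewrite /tagged_step; case E: (level_step _ _) => [x|] //= [Dx ->].
    by split=> //; apply/eqP; rewrite -level_step_East E Dx.
  have {hq} [Ms Vb] : M s = j'%:Z /\ b = - V s.
    move: hq; rewrite /tagged_step; case E: (level_step _ _) => [x|] //= [Dx ->].
    by split=> //; apply/eqP; rewrite -level_step_North E Dx.
  have {}none i t : slot_lt (j, r) (i, t) -> slot_lt (i, t) (j', s) ->
      (i <= 2 * n)%N -> - n%:Z <= t <= n%:Z -> M t != i%:Z /\ M t != i%:Z + 1.
    move=> lt1 lt2 i_n t_n.
    have := none (i, t); rewrite mem_slots /= t_n ltnS i_n => /(_ isT lt1 lt2).
    rewrite /tagged_step; case E: (level_step _ _) => [x|] // _.
    by move/eqP: E; rewrite level_step_None => /andP[].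
  rewrite /slot_lt /= in lt_pq none.
  (* On one level, if s is not r+1 then M(r+1) >= j+2, and M passes through j+1 again before
     reaching j at s: an E in between. *)
  have [jj|jj] := eqVneq j' j.
    have rs : r < s by lia.
    have [rs1|rs1] := eqVneq s (r + 1).
      by exists r; rewrite -rs1; split=> //; lia.
    have M1 := @M_step r; have N1 := none j (r + 1).
    have [||||u un Mu] := @discrete_ivt M (r + 1) s (j%:Z + 1); try lia.
      by move=> u un; apply: M_step; lia.
    have us : u != s by apply/eqP => us; rewrite us in Mu; lia.
    by have := none j u; lia.
  have {lt_pq}j'j : (j' < j)%N by lia.
  (* Here j >= 1, which rules out r = n-1. For r < n-1 the previous argument, run up to row n-1
     where M <= 1, gives another E on level j. *)
  have rn : r = n%:Z.
    apply/eqP; case: (eqVneq r n%:Z) => // r_n.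
    have [rE|r_n1] := eqVneq r (n%:Z - 1); first by move: M_pred_le1; rewrite -rE; lia.
    have M1 := @M_step r; have N1 := none j (r + 1).
    have [||||u un Mu] := @discrete_ivt M (r + 1) (n%:Z - 1) (j%:Z + 1); try lia.
      by move=> u un; apply: M_step; lia.
    by have := none j u; lia.
  rewrite rn in Mr.
  have ME : M (- n%:Z + 1) = - M (n%:Z - 1).
    by rewrite (_ : - n%:Z + 1 = - (n%:Z - 1)) /M ?oddifyN //; lia.
  have MN : M (- n%:Z) = - M n%:Z by rewrite /M oddifyN.
  have sN : s != - n%:Z by apply/eqP => sN; rewrite sN in Ms; lia.
  (* At level j-1, M is at least j at row -n+1 and below j at [s'], so an E is written before [s'].
     If j' = j-1 take s' = s; otherwise that whole level precedes s and row 0 will do. *)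
  have [s' [s'n Ms' lts']] : exists s', [/\ - n%:Z < s' <= n%:Z, M s' < j%:Z &
      (j' < j.-1)%N \/ s' = s].
    have [->|jj1] := eqVneq j' j.-1; first by exists s; split; [lia | lia | right].
    by exists 0; rewrite M0; split; [lia | lia | left; lia].
  have [||||u un Mu] := @discrete_ivt M (- n%:Z + 1) s' j%:Z; try lia.
    by move=> u un; apply: M_step; lia.
  have us : u != s' by apply/eqP => us; rewrite us in Mu; lia.
  by have := none j.-1 u; lia.
case=> r [rn Mr1 Mr -> ->]; have := @M_bound r => Mb.
(* As M(r) >= 1, this is the level M(r) - 1 at which row r writes E and row r+1 writes N. *)
pose j := (absz (M r)).-1.
exists (j, r), (j, r + 1); rewrite !mem_slots /slot_lt /=; split; try lia.
  rewrite /tagged_step.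
  have /eqP-> : level_step j (oddify mu r) == Some East.
    by rewrite level_step_East -/M; lia.
  have /eqP-> // : level_step j (oddify mu (r + 1)) == Some North.
  by rewrite level_step_North -/M; lia.
by move=> [i t] _ /=; lia.
Qed.

End Adjacent.

(** * Rises and the area vector *)

(** All values of [easts_before] at once, by structural recursion, to allow induction on the
    path. *)
Fixpoint easts (s : seq step) : seq nat :=
  match s with
  | [::] => [::]
  | North :: t => 0%N :: easts t
  | East :: t => [seq k.+1 | k <- easts t]
  end.

Lemma easts_beforeE s i : easts_before s i = nth 0%N (easts s) i.-1.
Proof.
rewrite /easts_before; congr (nth _ _ _); elim: s => // x s IHs.
have -> : iota 0 (size (x :: s)) = 0%N :: [seq k.+1 | k <- iota 0 (size s)].
  by rewrite /= (iotaDl 1 0).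
rewrite /= filter_map; case: x => /=.
  by rewrite -IHs -map_comp.
by rewrite -IHs -!map_comp.
Qed.

Lemma size_easts s : size (easts s) = count_mem North s.
Proof. by elim: s => // -[] s /= <-; rewrite ?size_map. Qed.

Lemma sorted_easts s : sorted leq (easts s).
Proof.
elim: s => // -[] s IHs /=; last by rewrite sorted_map.
by rewrite path_min_sorted //; apply/allP.
Qed.

Lemma begins_northE s :
  begins_north s = (0 < count_mem North s)%N && (nth 0%N (easts s) 0 == 0%N).
Proof.
rewrite -size_easts; case: s => // -[] s //=.
by rewrite size_map; case: (easts s).
Qed.

Lemma rise_North s i : rise (North :: s) i <->
  (i = 1%N /\ begins_north s) \/ exists2 k, i = k.+1 & rise s k.
Proof.
split.
  case=> -[|p] /andP[/andP[/= Np /eqP <-] Np1].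
    by left; rewrite take0 /=; split=> //; case: s Np1.
  by right; exists (count_mem North (take p.+1 s)) => //; exists p;
      rewrite /ith_step Np eqxx.
case=> [[-> Ns]|[k -> [p /andP[/andP[Np /eqP <-] Np1]]]].
  by exists 0%N; rewrite /ith_step /= take0 /=; case: s Ns.
by exists p.+1; rewrite /ith_step /= Np Np1 eqxx.
Qed.

Lemma rise_East s i : rise (East :: s) i <-> rise s i.
Proof.
split; last by case=> p ?; exists p.+1.
by case=> -[|p] //= ?; exists p.
Qed.

Lemma riseE s i : rise s i <->
  (0 < i < count_mem North s)%N /\ nth 0%N (easts s) i.-1 = nth 0%N (easts s) i.
Proof.
elim: s i => [|[] s IHs] i /=.
- by split=> [[p]|[]]; [rewrite /ith_step onth0n | lia].
- rewrite rise_North begins_northE; split.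
    case=> [[-> /andP[Ns /eqP N0]]|[k -> /IHs[kN E]]] /=.
      by rewrite N0; split=> //; lia.
    by case: k kN E => // k kN E; split=> //; lia.
  case: i => [|[|i]] [iN E]; first by lia.
    by left; split=> //; move: E => /= <-; rewrite eqxx andbT; lia.
  by right; exists i.+1 => //; apply/IHs; split=> //; lia.
rewrite rise_East IHs add0n.
suff nth_S : (0 < i < count_mem North s)%N ->
    (nth 0%N [seq k.+1 | k <- easts s] i.-1 = nth 0%N [seq k.+1 | k <- easts s] i <->
     nth 0%N (easts s) i.-1 = nth 0%N (easts s) i).
  by split=> -[iN]; [move/(nth_S iN).2 | move/(nth_S iN).1].
rewrite -size_easts => /andP[_ i1].
have i0 : (i.-1 < size (easts s))%N by apply: leq_ltn_trans (leq_pred i) i1.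
by rewrite !(nth_map 0%N) //; split=> [[]|->].
Qed.

Section LatticePath.
Variables (n : nat) (s : seq step).
Hypothesis s_path : lattice_path n s.

Let count_North : count_mem North s = n.
Proof. by case/andP: s_path => /eqP. Qed.

Lemma easts_before_mono i : (0 < i < n)%N -> (easts_before s i <= easts_before s i.+1)%N.
Proof.
move=> i_n; rewrite !easts_beforeE.
by apply: (sorted_leq_nth leq_trans leqnn _ (sorted_easts s));
   rewrite ?inE ?size_easts ?count_North; lia.
Qed.

Lemma riseP i :
  rise s i <-> (0 < i < n)%N /\ easts_before s i = easts_before s i.+1.
Proof. by rewrite riseE count_North !easts_beforeE. Qed.

Lemma begins_northP : (0 < n)%N -> begins_north s = (easts_before s 1 == 0%N).
Proof. by rewrite begins_northE count_North easts_beforeE => ->. Qed.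
End LatticePath.

(** * The canonical choice for the last row *)

Lemma eq_sweep mu mu' n m : mu =1 mu' -> sweep mu n m = sweep mu' n m.
Proof.
move=> E; rewrite /sweep; congr flatten; apply: eq_map => j; apply: eq_pmap => r.
by rewrite /oddify E.
Qed.

Lemma eq_window n mu mu' c c' m :
  mu =1 mu' -> c =1 c' -> window n mu c m = window n mu' c' m.
Proof.
move=> E E'; rewrite /window; congr flatten; apply: eq_map => i; congr (_ ++ _).
  by rewrite (eq_map E'); congr map; apply: eq_filter => j; rewrite E.
have E'' j : - c j = - c' j by rewrite E'.
by rewrite (eq_map E''); congr map; apply: eq_filter => j; rewrite E.
Qed.

Definition last_shift (n : nat) (s : seq step) : int :=
  (easts_before s n.-1)%:Z - n.-1%:Z - 1
  + 2 * ((easts_before s n)%:Z - (easts_before s n.-1)%:Z).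

Lemma mu_B_lt n s i : (i < n)%N -> mu_B n s i = (easts_before s i)%:Z - i%:Z.
Proof. by move=> i_n; rewrite /mu_B /lambda_B ltn_eqF. Qed.

(* Both the cases of lambda_n and those of n mod 4 only select one of the two
   alternatives, which the sign rule of d_B then detects. *)
Lemma mu_B_last n s : (1 < n)%N ->
  let m := last_shift n s in
  (mu_B n s n = m /\ ~~ (2 %| mu_B n s n.-1 + mu_B n s n)%Z) \/
  (mu_B n s n = 1 - m /\ (2 %| mu_B n s n.-1 + mu_B n s n)%Z).
Proof.
move=> n1 m; rewrite [mu_B n s n.-1]mu_B_lt; last by lia.
rewrite /m /last_shift /mu_B /lambda_B eqxx /=.
by case: (_ \in _); case: (odd _); lia.
Qed.

Section Canonical.
Variables (n : nat) (s : seq step) (v : int -> int).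
Hypothesis n_gt1 : (1 < n)%N.
Hypothesis s_path : lattice_path n s.

Let m := last_shift n s.

(** At height 1 the last row would end the sweep with an E; reflection moves it to height 0. *)
Definition canonical_mu (i : nat) : int :=
  if i == n then (if m == 1 then 0 else m) else mu_B n s i.

Definition canonical_label (i : nat) : int :=
  if (i == n) && (m == 1) then - v i%:Z else v i%:Z.

Lemma canonical_mu_lt i : (i < n)%N ->
  canonical_mu i = (easts_before s i)%:Z - i%:Z.
Proof. by move=> i_n; rewrite /canonical_mu ltn_eqF // mu_B_lt. Qed.

Lemma canonical_mu_last : canonical_mu n = if m == 1 then 0 else m.
Proof. by rewrite /canonical_mu eqxx. Qed.

Lemma canonical_data :
  (exists l, sweep canonical_mu n (2 * n).+1 = rcons (zeta_path n s) l) /\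
  window n canonical_mu canonical_label (2 * n).+1 = dB_window n s v.
Proof.
have [l zE] := zeta_path_sweep n s; rewrite dB_window_window.
set c := fun j : nat => _; have := mu_B_last s n_gt1; rewrite -/m => mu_n.
(* The actual last row is the canonical one or its reflection, the sign rule changing the label
   together with the height. *)
have [E|[muE cE]] :
    (mu_B n s n = canonical_mu n /\ c n = canonical_label n) \/
    (canonical_mu n = 1 - mu_B n s n /\ canonical_label n = - c n).
- rewrite canonical_mu_last /canonical_label /c eqxx /=.
  case: mu_n => -[E1 E2]; [rewrite (negbTE E2) E1 | rewrite E2 E1].
    by case: eqP => [->|_]; [right | left].
  by case: eqP => [->|_]; [left | right]; rewrite ?opprK; split=> //; lia.
- have muE i : canonical_mu i = mu_B n s i.
    by have [->|i_n] := eqVneq i n; [case: E | rewrite /canonical_mu (negbTE i_n)].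
  have cE i : canonical_label i = c i.
    have [->|i_n] := eqVneq i n; first by case: E.
    by rewrite /canonical_label /c (negbTE i_n).
  by rewrite (eq_sweep _ _ muE) (eq_window _ _ muE cE) -zE; split=> //; exists l.
have [k nk] : exists k, n = k.+1 by exists n.-1; lia.
have lt_n i : i \in iota 1 k -> (i == n) = false.
  by rewrite mem_iota nk; lia.
have mu_eq : {in iota 1 k, mu_B n s =1 canonical_mu}.
  by move=> i /lt_n i_n; rewrite /canonical_mu i_n.
have c_eq : {in iota 1 k, c =1 canonical_label}.
  by move=> i /lt_n i_n; rewrite /canonical_label /c i_n.
split; last first.
  rewrite nk in mu_eq c_eq muE cE *.
  by rewrite (window_reflect _ mu_eq muE c_eq cE).
(* Monotonicity gives |m| <= n, and the actual height is m or 1-m. *)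
have bound : - (2 * n)%:Z < mu_B n s n <= (2 * n)%:Z.
  have := easts_before_le n s_path; have := @easts_before_mono _ _ s_path n.-1.
  rewrite prednK; last by lia.
  by rewrite /m /last_shift in mu_n; lia.
move: zE; rewrite nk in mu_eq muE bound *.
have [t [l1 [l2 [-> ->]]]] := sweep_reflect mu_eq muE bound.
by move=> /rcons_inj[-> _]; exists l2.
Qed.

Lemma canonical_riseP i : (0 < i < n)%N ->
  rise s i <-> canonical_mu i.+1 = canonical_mu i - 1.
Proof.
move=> i_n; rewrite (riseP s_path) (@canonical_mu_lt i); last by lia.
have [i1|i1] := eqVneq i.+1 n; last first.
  by rewrite canonical_mu_lt; [split=> [[]|]; [lia | split=> //; lia] | lia].
rewrite i1 canonical_mu_last /m /last_shift -i1 /=.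
have := @easts_before_mono _ _ s_path i i_n; have := easts_before_le i s_path.
(* When m = 1 both sides fail: a rise would give m = e_n - n <= 0, while 0 = M(n-1) - 1 would give
   e_{n-1} = n and the even value m = 2(e_n - n). *)
by case: eqP => ? ? ?; (split=> [[_ ?]|?]; [|split=> //]); lia.
Qed.

(** Only the label of row n can be negated, and only if m = 1; a rise n-1 would make m = e_n - n <=
    0. *)
Lemma canonical_label_rise i : rise s i ->
  canonical_label i = v i%:Z /\ canonical_label i.+1 = v i.+1%:Z.
Proof.
rewrite (riseP s_path) => -[i_n E]; rewrite /canonical_label.
have -> : (i == n) = false by lia.
split=> //; case: ifP => // /andP[/eqP i1 /eqP].
rewrite /m /last_shift -i1 /= E.
by have := easts_before_le i.+1 s_path; lia.
Qed.

(** * Valleys of the image in terms of rises *)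

Lemma zetaB_valleyP a b :
  has_valley n (zetaB n (s, v)) a b <->
  exists r : int, [/\ - n%:Z <= r < n%:Z,
    oddify canonical_mu (r + 1) = oddify canonical_mu r - 1,
    1 <= oddify canonical_mu r,
    a = - oddify canonical_label r & b = - oddify canonical_label (r + 1)].
Proof.
have [[l zE] wE] := canonical_data.
have e_n := easts_before_le n s_path; have e_k := easts_before_le n.-1 s_path.
have e_kn : (easts_before s n.-1 <= easts_before s n)%N.
  by have := @easts_before_mono _ _ s_path n.-1; rewrite prednK; lia.
have bound i : (0 < i <= n)%N -> - (2 * n%:Z) <= canonical_mu i <= 2 * n%:Z.
  move=> i_n; have [->|i_neq] := eqVneq i n.
    by rewrite canonical_mu_last /m /last_shift; case: eqP; lia.
  rewrite canonical_mu_lt; last by lia.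
  by have := easts_before_le i s_path; lia.
have descent (i : nat) : (i < n)%N ->
    oddify canonical_mu i%:Z - 1 <= oddify canonical_mu i.+1%:Z.
  rewrite (oddify_nat _ (ltn0Sn i)); case: i => [|i] i_n.
    by rewrite oddify0 canonical_mu_lt //; lia.
  rewrite oddify_nat // canonical_mu_lt //.
  have := @easts_before_mono _ _ s_path i.+1; have [i1|i1] := eqVneq i.+2 n.
    by move: e_k; rewrite i1 canonical_mu_last /m /last_shift -i1 /=; case: eqP; lia.
  by rewrite canonical_mu_lt; lia.
have predE : oddify canonical_mu (n%:Z - 1) = (easts_before s n.-1)%:Z - n.-1%:Z.
  have -> : n%:Z - 1 = n.-1%:Z by lia.
  by rewrite oddify_nat ?canonical_mu_lt; lia.
have lastE : oddify canonical_mu n%:Z = if m == 1 then 0 else m.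
  by rewrite oddify_nat ?canonical_mu_last; lia.
have n_gt0 : (0 < n)%N by lia.
have H1 : oddify canonical_mu (n%:Z - 1) <= 1 by rewrite predE; lia.
(* With m in the last row the sum is 2(e_n - n) + 1. *)
have H2 : oddify canonical_mu (n%:Z - 1) + oddify canonical_mu n%:Z <= 1.
  by rewrite predE lastE /m /last_shift; case: eqP; lia.
have H3 : oddify canonical_mu n%:Z != 1 by rewrite lastE; case: (m =P 1) => // /eqP.
rewrite -(tagged_sweep_adjacent canonical_label n_gt0 bound descent H1 H2 H3).
rewrite /zetaB /dB /= -wE; apply: has_valley_tagged.
  by move=> i; rewrite mem_iota => i_n; apply: bound; lia.
have [t E] := sweep_last n_gt0 descent H1 H2 H3 (2 * n).
by move: (E); rewrite zE => /rcons_inj[_ <-].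
Qed.

(** The three cases are the rows r = i > 0, r = -i-1 < -1 and r = -1; row 0 has height 0 and writes
    no E. In the last case M(-1) = 1 means e_1 = 0. *)
Lemma zetaB_valley_riseP a b :
  has_valley n (zetaB n (s, v)) a b <->
  [\/ exists i : nat, [/\ rise s i, 1 <= canonical_mu i, a = - v i%:Z & b = - v i.+1%:Z],
      exists i : nat, [/\ rise s i, canonical_mu i <= 0, a = v i.+1%:Z & b = v i%:Z]
    | [/\ begins_north s, a = v 1 & b = 0]].
Proof.
have n0 : (0 < n)%N by lia.
have north1 : begins_north s = (canonical_mu 1 == -1).
  by rewrite (begins_northP s_path n0) canonical_mu_lt //; lia.
have label1 : canonical_label 1 = v 1.
  by rewrite /canonical_label; have -> : (1%N == n) = false by lia.
rewrite zetaB_valleyP; split.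
  case=> r [rn Mr1 Mr -> ->]; have [r1|r1] := ltP 0 r.
    have [i ri] : exists i : nat, r = i%:Z by exists (absz r); lia.
    have i_n : (0 < i < n)%N by lia.
    move: Mr1 Mr; rewrite ri (_ : i%:Z + 1 = i.+1%:Z); last by lia.
    rewrite !oddify_nat; [|lia..].
    move=> /(canonical_riseP i_n) Ri Mi; constructor 1; exists i.
    by have [-> ->] := canonical_label_rise Ri.
  have [r2|r2] := ltP r (-1).
    have [i ri] : exists i : nat, r = - i.+1%:Z by exists (absz r).-1; lia.
    have i_n : (0 < i < n)%N by lia.
    move: Mr1 Mr; rewrite ri (_ : - i.+1%:Z + 1 = - i%:Z); last by lia.
    rewrite !oddifyN !oddify_nat ?opprK; [|lia..].
    move=> Mi Mi1; have Ri : rise s i by apply/(canonical_riseP i_n); lia.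
    constructor 2; exists i.
    by have [-> ->] := canonical_label_rise Ri; split=> //; lia.
  have [r0|r_1] : r = 0 \/ r = -1 by lia.
    by move: Mr; rewrite r0 oddify0.
  move: Mr1; rewrite r_1 addNr (oddifyN _ 1) !oddify0 (oddifyN _ 1).
  rewrite !(oddify_nat _ (ltn0Sn 0)) opprK oppr0 label1 => M1.
  by constructor 3; split=> //; rewrite north1; lia.
case=> [[i [Ri Mi -> ->]]|[i [Ri Mi -> ->]]|[sN -> ->]].
- have [i_n _] := (riseP s_path i).1 Ri; have [Vi Vi1] := canonical_label_rise Ri.
  move/(canonical_riseP i_n): Ri => Mi1.
  exists i%:Z; rewrite (_ : i%:Z + 1 = i.+1%:Z); last by lia.
  by rewrite !oddify_nat; [rewrite Vi Vi1; split=> //; lia | lia..].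
- have [i_n _] := (riseP s_path i).1 Ri; have [Vi Vi1] := canonical_label_rise Ri.
  move/(canonical_riseP i_n): Ri => Mi1.
  exists (- i.+1%:Z); rewrite (_ : - i.+1%:Z + 1 = - i%:Z); last by lia.
  rewrite !oddifyN !oddify_nat; [|lia..].
  by rewrite Vi Vi1 !opprK; split=> //; lia.
exists (-1); rewrite addNr (oddifyN _ 1) !oddify0 (oddifyN _ 1).
rewrite !(oddify_nat _ (ltn0Sn 0)) opprK oppr0 label1.
by move: sN; rewrite north1 => /eqP->; split=> //; lia.
Qed.

End Canonical.

Theorem theorem6p19 (n : nat) (hn : (2 <= n)%N)
    (pi : seq step) (v : int -> int) (hpv : VertB n (pi, v)) :
  (forall a b : int,
     (exists2 k : nat, (1 <= k <= n)%N & a = v k%:Z) ->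
     (exists2 k : nat, (1 <= k <= n)%N & b = v k%:Z) ->
     (has_rise (pi, v) a b <->
      has_valley n (zetaB n (pi, v)) b a \/
      has_valley n (zetaB n (pi, v)) (- a) (- b))) /\
  (begins_north pi <-> has_valley n (zetaB n (pi, v)) (v 1) 0).
Proof.
case: hpv => /= pi_path [v_pm v_inj _ v_odd _] _ _.
have pm_nat k : (1 <= k <= n)%N -> k%:Z \in pm n by rewrite pmE.
have v_neq0 k : (1 <= k <= n)%N -> v k%:Z != 0.
  by move/pm_nat/v_pm; rewrite pmE; lia.
(* No two elements of v([n]) are opposite, so a label determines the sign with which it occurs. *)
have v_neqN k l : (1 <= k <= n)%N -> (1 <= l <= n)%N -> v k%:Z <> - v l%:Z.
  move=> kn ln; rewrite -v_odd ?pm_nat // => E.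
  have l_pm : - l%:Z \in pm n by rewrite pmE abszN.
  by have := v_inj _ _ (pm_nat k kn) l_pm E; lia.
have valleyE := zetaB_valley_riseP v hn pi_path.
have rise_n i : rise pi i -> (1 <= i < n)%N by case/(riseP pi_path).
split=> [a b [k kn ak] [l ln bl]|].
  rewrite !valleyE /has_rise /=; split.
    case=> i Ri [<- <-]; have [Mi|Mi] := leP 1 (canonical_mu n pi i).
      by right; constructor 1; exists i.
    by left; constructor 2; exists i; split=> //; lia.
  (* Only two of the six cases survive: the label (b, a) from a negative row and (-a, -b) from a
     positive one. The others make b opposite to an element of v([n]), or make a or b zero. *)
  case=> [] [[i [Ri _ E1 E2]]|[i [Ri _ E1 E2]]|[_ E1 E2]].
  - by case: (@v_neqN l i) => //; [have := rise_n i Ri; lia | rewrite -bl].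
  - by exists i; rewrite ?E1 ?E2.
  - by have := v_neq0 k kn; rewrite -ak E2 eqxx.
  - by exists i => //; rewrite -[a]opprK -[b]opprK E1 E2 !opprK.
  - case: (@v_neqN l i) => //; first by have := rise_n i Ri; lia.
    by rewrite -bl -E2 opprK.
  - by have := v_neq0 l ln; rewrite -bl -oppr_eq0 E2 eqxx.
rewrite valleyE; split=> [piN|]; first by constructor 3.
(* Valleys coming from rises have nonzero labels, so a second label 0 leaves only the initial North
   step. *)
case=> [[i [/rise_n i_n _ _ E]]|[i [/rise_n i_n _ _ E]]|[]] //.
  by have := v_neq0 i.+1; rewrite -oppr_eq0 -E eqxx; lia.
by have := v_neq0 i; rewrite -E eqxx; lia.
Qed.
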